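(* Let $\Psi:\mathbb{R}^2\to\mathbb{R}^2$ be locally Lipschitz continuous and let $\sigma\ge0$ be a constant. Let $(\Omega,\mathcal{F},\mathbb{P},\{\mathcal{F}_t\}_{t\ge0})$ be a filtered probability space together with a one-dimensional $\{\mathcal{F}_t\}_{t\ge0}$-Brownian motion $W=\{W_t\}_{t\ge0}$. Then for each $\mathcal{F}_0$-measurable $x_0:\Omega\to\mathbb{R}^3$ there exists a unique $\{\mathcal{F}_t\}_{t\ge0}$-adapted continuous $\mathbb{R}^3$-valued process $X=\{X_t\}_{t\ge0}$, $X_t=(\xi_t,\alpha_t)\in\mathbb{R}^2\times\mathbb{R}$, which satisfies $X_0=x_0$ $\mathbb{P}$-a.s. and solves, in integral form (for all $t\ge0$), the It\^o equation $$\mathrm{d}\xi_t=\tau(\alpha_t)\,\mathrm{d}t,\qquad \mathrm{d}\alpha_t=\Psi(\xi_t)\cdot\tau^\bot(\alpha_t)\,\mathrm{d}t+\sigma\,\mathrm{d}W_t .$$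
   Context: $\tau(\alpha)=(\cos\alpha,\sin\alpha)^T$ and $\tau^\bot(\alpha)=\frac{\partial\tau}{\partial\alpha}(\alpha)=(-\sin\alpha,\cos\alpha)^T$ for $\alpha\in\mathbb{R}$; $\cdot$ between vectors is the Euclidean scalar product. Uniqueness is understood up to indistinguishability. The filtered probability space is a standard one (satisfying the usual conditions). *)

(* Defs.v *)
From HB Require Import structures.
From mathcomp Require Import all_boot all_order all_algebra.
From mathcomp Require Import all_classical all_reals all_analysis.

Set Implicit Arguments.
Unset Strict Implicit.
Unset Printing Implicit Defensive.

Import Order.TTheory GRing.Theory Num.Theory.
Import numFieldNormedType.Exports.

Local Open Scope classical_set_scope.
Local Open Scope ring_scope.

(* R^2 is R * R and R^3 = R^2 x R is R * R * R, so that X_t = (xi_t, alpha_t)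
   has xi_t = (X t w).1 and alpha_t = (X t w).2. The library norm on R * R is
   the maximum norm, which has the same locally Lipschitz maps as the
   Euclidean one. *)

Definition tau (R : realType) (a : R) : R * R := (cos a, sin a).

Definition tau_perp (R : realType) (a : R) : R * R := (- sin a, cos a).

Definition dot (R : realType) (u v : R * R) : R := u.1 * v.1 + u.2 * v.2.

Definition plane_integral (R : realType) (D : set R) (f : R -> R * R) : R * R :=
  (\int[@lebesgue_measure R]_(s in D) (f s).1,
   \int[@lebesgue_measure R]_(s in D) (f s).2).

(* Filtrations and processes are indexed by all of R; only the indices t >= 0
   are ever constrained or compared. *)

Definition measurable_wrt (d' : measure_display) (T : Type)
    (U : measurableType d') (G : set (set T)) (f : T -> U) : Prop :=
  forall B : set U, measurable B -> G (f @^-1` B).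

Definition adapted (d' : measure_display) (R : realType) (T : Type)
    (U : measurableType d') (F : R -> set (set T)) (X : R -> T -> U) : Prop :=
  forall t : R, 0 <= t -> measurable_wrt (F t) (X t).

Record usual_filtration (d : measure_display) (T : measurableType d)
    (R : realType) (P : probability T R) (F : R -> set (set T)) : Prop := {
  filtration_sigma_algebra :
    forall t : R, 0 <= t -> sigma_algebra setT (F t);
  filtration_measurable :
    forall t : R, 0 <= t -> F t `<=` measurable;
  filtration_mono :
    forall s t : R, 0 <= s -> s <= t -> F s `<=` F t;
  filtration_null :
    P.-negligible `<=` F 0;
  filtration_right_continuous :
    forall t : R, 0 <= t -> \bigcap_(u in [set u | t < u]) F u `<=` F t
}.

Definition continuous_process (R : realType) (T : Type)
    (U : topologicalType) (X : R -> T -> U) : Prop :=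
  forall w : T, {within `[0, +oo[, continuous (fun t => X t w)}.

Definition increment (R : realType) (T : Type) (W : R -> T -> R) (s t : R) :
  T -> R := fun w => W t w - W s w.

(* The second parameter of normal_prob is the standard deviation. *)
Record brownian_motion (d : measure_display) (T : measurableType d)
    (R : realType) (P : probability T R) (F : R -> set (set T))
    (W : R -> T -> R) : Prop := {
  brownian_adapted : adapted F W;
  brownian_start : {ae P, forall w, W 0 w = 0};
  brownian_continuous :
    {ae P, forall w, {within `[0, +oo[, continuous (fun t => W t w)}};
  brownian_indep : forall s t : R, 0 <= s -> s < t ->
    forall (A : set T) (B : set R), F s A -> measurable B ->
      P (A `&` increment W s t @^-1` B) =
      (P A * P (increment W s t @^-1` B))%E;
  brownian_normal : forall s t : R, 0 <= s -> s < t ->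
    forall B : set R, measurable B ->
      P (increment W s t @^-1` B) = normal_prob 0 (Num.sqrt (t - s)) B
}.

(* The integrand of the stochastic integral is the constant sigma, an
   elementary process, so the Ito integral from 0 to t is by definition
   sigma * (W t - W 0). *)
Record solution (d : measure_display) (T : measurableType d) (R : realType)
    (P : probability T R) (F : R -> set (set T)) (W : R -> T -> R)
    (Psi : R * R -> R * R) (sigma : R) (x0 : T -> R * R * R)
    (X : R -> T -> R * R * R) : Prop := {
  solution_adapted : adapted F X;
  solution_continuous : continuous_process X;
  solution_start : {ae P, forall w, X 0 w = x0 w};
  solution_equation : {ae P, forall w, forall t : R, 0 <= t ->
    (X t w).1 = (X 0 w).1 + plane_integral `[0, t] (fun s => tau (X s w).2) /\
    (X t w).2 = (X 0 w).2
      + \int[@lebesgue_measure R]_(s in `[0, t])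
          dot (Psi (X s w).1) (tau_perp (X s w).2)
      + sigma * increment W 0 t w}
}.

Definition indistinguishable (d : measure_display) (T : measurableType d)
    (R : realType) (P : probability T R) (U : Type) (X Y : R -> T -> U) : Prop :=
  {ae P, forall w, forall t : R, 0 <= t -> X t w = Y t w}.

(* Main.v *)
Require Import Defs.
From mathcomp Require Import all_boot all_order all_algebra.
From mathcomp Require Import all_classical all_reals all_analysis.
From mathcomp Require Import measurable_realfun ring lra.
Import Order.TTheory GRing.Theory Num.Theory.
Import numFieldNormedType.Exports.

Local Open Scope classical_set_scope.
Local Open Scope ring_scope.

(** The noise is additive, so the equation is solved path by path. For fixed
[w], put [b t = sigma * (W t w - W 0 w)]; the Ito equation becomes the
deterministic integral equation
    X t = x0 + (integral from 0 to t of [drift Psi (X s)]) + (0, b t)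
in R^3, where [drift Psi (xi, alpha) = (tau alpha, Psi xi . tau_perp alpha)].

The drift is only locally Lipschitz, but its planar part [tau alpha] is bounded
by [1], so every Picard iterate, and every solution, keeps its planar part
within distance [N] of its starting point up to time [N]. A locally Lipschitz
[Psi] is Lipschitz and bounded on this compact box
([locally_lipschitz_compact]), and [tau], [tau_perp] are bounded and globally
Lipschitz, hence the drift is Lipschitz with some constant [L] on the part of
R^3 that matters before time [N] ([drift_lipschitz]). In the weighted norm
[sup exp (- 2 L t) |u t|] over [[0, N]] the Picard operator then contracts by a
factor [1/2] ([picard_contract]). This gives the locally uniform convergence of
the Picard iterates to a fixed point for all times ([picard_lim_fixed]), as well
as uniqueness ([picard_fixed_unique]).

The solution is adapted because it is a pointwise limit of Picard iterates,
each of which is adapted by induction: the integral of a continuous path over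
[[0, t]] is the limit of Riemann sums that only involve times in [[0, t]]
([riemann_sum_cvg], [measurable_picard_iter]). On the exceptional event where
the path of [W] is not continuous, the noise is replaced by [0]; this event is
negligible, hence belongs to [F 0] by completeness, so adaptedness is not
affected.

Paths defined on the half-line are extended to the real line by composition
with [t |-> max t 0], so that continuity always refers to the whole line. *)

Set Implicit Arguments.
Unset Strict Implicit.
Unset Printing Implicit Defensive.

(** * Locally Lipschitz maps *)

(** The hypothesis localizes around points of the product, that is around pairs
[(x, y)], possibly off the diagonal. *)
Lemma locally_lipschitz_near (R : realType) (V W : normedModType R)
    (f : V -> W) (p : V * V) :
  [locally [lipschitz f x | x in setT]] ->
  exists2 M, 0 < M &
    \forall q \near p, `|f q.1 - f q.2| <= M * `|q.1 - q.2|.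
Proof.
move=> /(_ p (conj I I))/pinfty_ex_gt0[M M0].
rewrite /dominated_by /within /= => HM; exists M => //.
by near=> q; apply: (near HM q).
Unshelve. all: by end_near. Qed.

Lemma locally_lipschitz_continuous (R : realType) (V W : normedModType R)
    (f : V -> W) :
  [locally [lipschitz f x | x in setT]] -> continuous f.
Proof.
move=> lipf x; have [M M0 HM] := locally_lipschitz_near (x, x) lipf.
apply/cvgrPdist_lt => e e0.
have : \forall y \near x, `|f x - f y| <= M * `|x - y|.
  have : (x, y) @[y --> x] --> (x, x).
    by apply: cvg_pair => //; exact: cvg_cst.
  by move=> /(_ _ HM).
apply: filter_app; near=> y; move=> h; apply: (le_lt_trans h).
rewrite mulrC -ltr_pdivlMr//; near: y.
by apply: cvgr_dist_lt => //; rewrite divr_gt0.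
Unshelve. all: by end_near. Qed.

(** The Lipschitz bound is a local property of pairs of points, and a larger
constant is also admissible; compactness of [K `*` K] makes it uniform. *)
Lemma locally_lipschitz_compact (R : realType) (V W : normedModType R)
    (f : V -> W) (K : set V) :
  [locally [lipschitz f x | x in setT]] -> compact K ->
  exists2 L, 0 < L & forall x y, K x -> K y -> `|f x - f y| <= L * `|x - y|.
Proof.
move=> lipf cK.
have /compact_near_coveringP cKK := compact_setX cK cK.
have : \forall M \near +oo, K `*` K `<=`
    (fun p => `|f p.1 - f p.2| <= M * `|p.1 - p.2|).
  apply: (cKK R +oo (fun M p => `|f p.1 - f p.2| <= M * `|p.1 - p.2|)) => p Kp.
  have [M M0 HM] := locally_lipschitz_near p lipf.
  exists ([set q | `|f q.1 - f q.2| <= M * `|q.1 - q.2|],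
          [set m | M <= m]) => /=.
    by split; [exact: HM|apply: nbhs_pinfty_ge; rewrite num_real].
  move=> [q m] /= [qM Mm]; apply: (le_trans qM).
  by rewrite ler_wpM2r.
move=> /pinfty_ex_gt0[L L0 HL]; exists L => // x y Kx Ky.
exact: (HL (x, y)).
Qed.

(** * Integrals of continuous functions over an interval starting at 0 *)

Section integral_from_0.
Context {R : realType}.
Implicit Types (f g : R -> R) (t : R).
Local Notation mu := (@lebesgue_measure R).

Lemma continuous_integrable_itv f a b :
  continuous f -> mu.-integrable `[a, b] (EFin \o f).
Proof.
move=> cf; apply: continuous_compact_integrable; first exact: segment_compact.
exact: continuous_subspaceT.
Qed.

Lemma continuous_norm f : continuous f -> continuous (fun s => `|f s|).
Proof. by move=> cf s; apply: cvg_norm; exact: cf. Qed.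

(** The integral of [f] over [[0, t]]; it is [0] for negative [t]. *)
Definition integral0 f t := \int[mu]_(s in `[0, t]) f s.

(** The primitive [J] is based at [-1], so that it is differentiable on a
neighbourhood of [0]. *)
Lemma integral0_primitive f : continuous f ->
  exists J : R -> R, (forall t, -1 < t -> is_derive t 1 J (f t)) /\
    (forall t, 0 <= t -> integral0 f t = J t - J 0).
Proof.
move=> cf; exists (fun t => \int[mu]_(s in `[-1, t]) f s); split.
  move=> t t1.
  have tt1 : t < t + 1 by rewrite ltrDl.
  have [d E] := continuous_FTC1_closed tt1
    (continuous_integrable_itv (-1) (t + 1) cf) t1 (cf t).
  by apply: DeriveDef; [exact: d|rewrite -derive1E; exact: E].
move=> t t0.
have N1 : (-1 : R) <= 0 by rewrite lerN10.
rewrite (@Rintegral_itvB R f (BLeft (-1)) (BRight t) 0) ?bnd_simp//; last first.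
  exact: continuous_integrable_itv.
rewrite Rintegral_itv_obnd_cbnd//.
apply: integrableS (continuous_integrable_itv 0 t cf) => //.
by apply: subset_itvr; rewrite bnd_simp.
Qed.

Lemma integral0_at0 f : integral0 f 0 = 0.
Proof. by rewrite /integral0 set_itv1 Rintegral_set1. Qed.

Lemma continuous_maxr0 : continuous (fun t : R => Num.max t 0).
Proof.
by move=> t; apply: continuous_max; [exact: cvg_id|exact: cvg_cst].
Qed.

Lemma maxr0_ge0 t : 0 <= Num.max t 0.
Proof. by rewrite le_max lexx orbT. Qed.

Lemma continuous_integral0 f : continuous f ->
  continuous (fun t => integral0 f (Num.max t 0)).
Proof.
move=> /integral0_primitive[J [dJ EJ]].
have -> : (fun t => integral0 f (Num.max t 0)) =
          (fun t => J (Num.max t 0) - J 0).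
  by apply/funext => t; rewrite EJ// maxr0_ge0.
move=> t; apply: cvgB; last exact: cvg_cst.
apply: (@continuous_comp _ _ _ (fun t => Num.max t 0) J).
  exact: continuous_maxr0.
apply: differentiable_continuous; apply/derivable1_diffP.
by have [] := dJ (Num.max t 0) (lt_le_trans (ltrN10 R) (maxr0_ge0 t)).
Qed.

Lemma integral0_le f g t : continuous f -> continuous g ->
  (forall s, 0 <= s <= t -> `|f s| <= g s) ->
  `|integral0 f t| <= integral0 g t.
Proof.
move=> cf cg fg.
apply: (le_trans (le_normr_Rintegral _ _)) => //.
  exact: continuous_integrable_itv.
apply: le_Rintegral => //.
- apply: continuous_integrable_itv; exact: continuous_norm.
- exact: continuous_integrable_itv.
Qed.

Lemma integral0B f g t : continuous f -> continuous g ->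
  integral0 f t - integral0 g t = integral0 (fun s => f s - g s) t.
Proof.
move=> cf cg; rewrite /integral0 RintegralB//;
  exact: continuous_integrable_itv.
Qed.

Lemma integral0_derive f (G : R -> R) t : continuous f ->
  (forall s : R, is_derive s 1 G (f s)) -> 0 <= t ->
  integral0 f t = G t - G 0.
Proof.
move=> cf dG t0; have [J [dJ ->//]] := integral0_primitive cf.
have dGJ (s : R) : -1 < s -> is_derive s 1 (fun x => G x - J x) 0.
  move=> s1; have ? := dJ s s1; have ? := dG s.
  by apply: is_derive_eq; rewrite subrr.
have cGJ : {within `[0, t], continuous (fun x => G x - J x)}.
  apply: derivable_within_continuous => s; rewrite in_itv/= => /andP[s0 _].
  by have [] := dGJ s (lt_le_trans (ltrN10 R) s0).
have dGJ0 (s : R) : s \in `]0, t[ -> is_derive s 1 (fun x => G x - J x) 0.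
  by rewrite in_itv/= => /andP[s0 _]; apply: dGJ; exact: lt_trans s0.
have [c _] := MVT_segment t0 dGJ0 cGJ.
by rewrite mul0r => h; lra.
Qed.

Lemma continuous_expRM (C a : R) : continuous (fun s => C * expR (a * s)).
Proof.
move=> s; apply: cvgMr; apply: (@continuous_comp _ _ _ (fun s => a * s) expR).
  by apply: cvgMr; exact: cvg_id.
exact: continuous_expR.
Qed.

(** The exponential weight [exp (2 L t)] gains a factor [1/2] when it is
multiplied by the Lipschitz constant [L] and integrated. *)
Lemma integral0_expR (C L t : R) : 0 < L -> 0 <= t -> 0 <= C ->
  integral0 (fun s => L * (C * expR (2 * L * s))) t <=
    C / 2 * expR (2 * L * t).
Proof.
move=> L0 t0 C0; under [X in integral0 X]funext do rewrite mulrA.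
have dG (s : R) : is_derive s 1 (fun s => C / 2 * expR (2 * L * s))
    (L * C * expR (2 * L * s)).
  by apply: is_derive_eq; rewrite /GRing.scale/=; field.
rewrite (integral0_derive (@continuous_expRM (L * C) (2 * L)) dG t0).
by rewrite lerBlDr lerDl mulr_ge0 ?divr_ge0 ?expR_ge0.
Qed.

Lemma continuous_unif_segment f a b e : continuous f -> 0 < e ->
  exists2 d, 0 < d &
    forall x y, a <= x <= b -> `|x - y| < d -> `|f x - f y| < e.
Proof.
move=> cf e0; have /compact_near_coveringP cK := @segment_compact R a b.
have : \forall d \near 0^'+, `[a, b] `<=`
    (fun x => forall y, `|x - y| < d -> `|f x - f y| < e).
  apply: (cK R 0^'+ (fun d x => forall y, `|x - y| < d -> `|f x - f y| < e)).
  move=> x _; have e20 : 0 < e / 2 by rewrite divr_gt0.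
  have /cvgrPdist_lt/(_ _ e20)/nbhs_ballP[d /= d0 xd] := cf x.
  exists (ball x (d / 2), [set d' | d' <= d / 2]) => /=.
    split; first by apply: nbhsx_ballx; rewrite divr_gt0.
    by apply: nbhs_right_le; rewrite divr_gt0.
  move=> [x' d'] /=; rewrite /ball/= => -[xx' d'd] y x'y.
  have H1 : `|f x - f x'| < e / 2 by apply: xd; rewrite /ball/=; lra.
  have H2 : `|f x - f y| < e / 2.
    apply: xd; rewrite /ball/= (le_lt_trans (ler_distD x' x y))//; lra.
  rewrite (le_lt_trans (ler_distD (f x) _ _))// distrC; lra.
move=> H; near (0 : R)^'+ => d.
exists d => // x y xab; apply: (near H d) => //=.
Unshelve. all: by end_near. Qed.

(** The left Riemann sum of [f] over [[0, t]] for the subdivision into [n.+1]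
intervals of equal length. *)
Definition riemann_sum f t n : R :=
  \sum_(k < n.+1) f (k%:R * (t / n.+1%:R)) * (t / n.+1%:R).

(** The mean value theorem, applied to a primitive on each interval of the
subdivision, replaces the integral by a Riemann sum with other sample points. *)
Lemma riemann_sum_cvg f t : continuous f -> 0 <= t ->
  riemann_sum f t @ \oo --> integral0 f t.
Proof.
move=> cf t0; have [J [dJ ->//]] := integral0_primitive cf.
apply/cvgrPdist_le => e e0.
have e'0 : 0 < e / (t + 1) by rewrite divr_gt0//; lra.
have [d d0 fd] := continuous_unif_segment 0 t cf e'0.
near=> n.
pose h := t / n.+1%:R.
have h0 : 0 <= h by rewrite divr_ge0.
have hd : h < d.
  rewrite ltr_pdivrMr// -ltr_pdivrMl// mulrC (@lt_le_trans _ _ n%:R) ?ler_nat//.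
  by near: n; exact: nbhs_infty_gtr.
have hn : n.+1%:R * h = t by rewrite mulrC divfK// pnatr_eq0.
have -> : J t - J 0 = \sum_(k < n.+1) (J (k.+1%:R * h) - J (k%:R * h)).
  rewrite -(big_mkord xpredT (fun k => J (k.+1%:R * h) - J (k%:R * h))).
  by rewrite telescope_sumr// hn mul0r.
rewrite /riemann_sum -sumrB (le_trans (ler_norm_sum _ _ _))//.
(* [f] varies by less than [e / (t + 1)] on an interval of length [h < d]. *)
have step (k : 'I_n.+1) :
    `|J (k.+1%:R * h) - J (k%:R * h) - f (k%:R * h) * h| <= e / (t + 1) * h.
  have kh : k%:R * h <= k.+1%:R * h by rewrite ler_wpM2r// ler_nat.
  have k0 : 0 <= k%:R * h by rewrite mulr_ge0.
  have dJk (s : R) : s \in `]k%:R * h, k.+1%:R * h[ -> is_derive s 1 J (f s).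
    by rewrite in_itv/= => /andP[ks _]; apply: dJ; lra.
  have cJk : {within `[k%:R * h, k.+1%:R * h], continuous J}.
    apply: derivable_within_continuous => s; rewrite in_itv/= => /andP[ks _].
    have ? : is_derive s 1 J (f s) by apply: dJ; lra.
    exact: ex_derive.
  have [c] := MVT_segment kh dJk cJk.
  have -> : k.+1%:R * h - k%:R * h = h by rewrite -natr1; ring.
  rewrite in_itv/= => /andP[kc ck] ->.
  rewrite -mulrBl normrM (ger0_norm h0) ler_wpM2r// ltW// distrC fd//.
    by rewrite k0/= -hn ler_wpM2r// ler_nat; exact: ltnW.
  rewrite distrC ger0_norm ?subr_ge0// (le_lt_trans _ hd)//.
  by move: ck; rewrite -natr1; lra.
apply: (le_trans (ler_sum _ (fun k _ => step k))).
rewrite sumr_const card_ord -mulr_natr -(mulrA _ h) (mulrC h) hn.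
by rewrite mulrAC ler_pdivrMr; [rewrite ler_pM2l//; lra|lra].
Unshelve. all: by end_near. Qed.

End integral_from_0.

(** * Sequences with geometrically decreasing steps *)

(** The sequences [u n - g n] and [u n + g n], where [g n = 2 D / 2 ^ n], are
adjacent. *)
Lemma geometric_step_cvg (R : realType) (u : R^nat) (D : R) :
  (forall n, `|u n.+1 - u n| <= D / 2 ^+ n) ->
  cvgn u /\ forall n, `|limn u - u n| <= 2 * D / 2 ^+ n.
Proof.
move=> uD; pose g n : R := 2 * D / 2 ^+ n.
have gS n : g n - g n.+1 = D / 2 ^+ n.
  rewrite /g exprS; field; by rewrite expf_neq0.
have aI : nondecreasing_seq (fun n => u n - g n).
  apply/nondecreasing_seqP => n.
  have := uD n; rewrite ler_norml -gS; lra.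
have vD : nonincreasing_seq (fun n => u n + g n).
  apply/nonincreasing_seqP => n.
  have := uD n; rewrite ler_norml -gS; lra.
have g0 : g @ \oo --> (0 : R).
  have -> : g = geometric (2 * D) 2^-1.
    by apply/funext => n; rewrite /g/= exprVn.
  by apply: cvg_geometric; rewrite ger0_norm; lra.
have cv0 : ((fun n => u n + g n) - (fun n => u n - g n)) @ \oo --> (0 : R).
  have -> : (fun n => u n + g n) - (fun n => u n - g n) = (fun n => g n + g n).
    by apply/funext => n; rewrite !fctE; ring.
  by rewrite -[0]addr0; exact: cvgD.
have [av ca cv] := adjacent_seq aI vD cv0.
have uE : u = (fun n => u n - g n) \+ g by apply/funext => n; rewrite /= subrK.
have cu : u @ \oo --> limn (fun n => u n - g n).
  by rewrite [X in X @ _]uE -[X in _ --> X]addr0; apply: cvgD.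
split; first by apply/cvg_ex; eexists; exact: cu.
move=> n; rewrite (cvg_lim _ cu)//.
have H1 := nondecreasing_cvgn_le aI ca n.
have H2 := nonincreasing_cvgn_ge vD cv n.
rewrite -/(g n) ler_norml; move: H1 H2 av => /=; lra.
Qed.

Lemma geometric_small (R : realType) (D e : R) : 0 < e ->
  exists n, D / 2 ^+ n <= e.
Proof.
move=> e0.
have : geometric D 2^-1 @ \oo --> (0 : R).
  by apply: cvg_geometric; rewrite ger0_norm; lra.
move=> /cvgr_norm_le/(_ e); rewrite normr0 => /(_ e0) H; near \oo => n.
exists n; have : `|geometric D 2^-1 n| <= e by near: n.
by rewrite /= exprVn; apply: le_trans; exact: ler_norm.
Unshelve. all: by end_near. Qed.

Lemma eq_of_geometric_bound (R : realType) (V : normedModType R) (x y : V)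
    (D : R) : (forall n, `|x - y| <= D / 2 ^+ n) -> x = y.
Proof.
move=> xyD; apply/eqP; rewrite -subr_eq0 -normr_le0; apply/ler_addgt0Pr => e e0.
by have [n nD] := geometric_small D e0; rewrite add0r (le_trans (xyD n)).
Qed.

(** * Paths in R^3 *)

Section coordinates.
Context {R : realType}.
Local Notation E := (R * R * R)%type.

Lemma norm3_le (x : E) (c : R) :
  `|x| <= c <-> [/\ `|x.1.1| <= c, `|x.1.2| <= c & `|x.2| <= c].
Proof.
rewrite !prod_normE/= !ge_max; split=> [/andP[/andP[]]//|[-> -> ->]//].
Qed.

Lemma norm_fst_le (x : E) : `|x.1| <= `|x|.
Proof. by rewrite [leRHS]prod_normE le_max lexx. Qed.

Lemma norm_snd_le (x : E) : `|x.2| <= `|x|.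
Proof. by rewrite [leRHS]prod_normE le_max lexx orbT. Qed.

Lemma continuous3P (T : topologicalType) (u : T -> E) :
  continuous u <-> [/\ continuous (fun s => (u s).1.1),
    continuous (fun s => (u s).1.2) & continuous (fun s => (u s).2)].
Proof.
split=> [cu|[c1 c2 c3] s].
  split=> s.
  - apply: (@continuous_comp _ _ _ u (fun x => x.1.1)); first exact: cu.
    by apply: (@continuous_comp _ _ _ fst fst); exact: cvg_fst.
  - apply: (@continuous_comp _ _ _ u (fun x => x.1.2)); first exact: cu.
    by apply: (@continuous_comp _ _ _ fst snd); [exact: cvg_fst|exact: cvg_snd].
  - apply: (@continuous_comp _ _ _ u (fun x => x.2)); first exact: cu.
    exact: cvg_snd.
have -> : u = (fun s => ((u s).1.1, (u s).1.2, (u s).2)).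
  by apply/funext => r; case: (u r) => [[]].
apply: (@cvg_pair _ _ _ _ (nbhs ((u s).1.1, (u s).1.2)) (nbhs (u s).2));
  last exact: c3.
apply: (@cvg_pair _ _ _ _ (nbhs (u s).1.1) (nbhs (u s).1.2)); first exact: c1.
exact: c2.
Qed.

(** The coordinatewise integral of a path over [[0, t]]. *)
Definition vintegral0 (u : R -> E) (t : R) : E :=
  (integral0 (fun s => (u s).1.1) t, integral0 (fun s => (u s).1.2) t,
   integral0 (fun s => (u s).2) t).

Lemma vintegral0_le (u : R -> E) (g : R -> R) t :
  continuous u -> continuous g ->
  (forall s, 0 <= s <= t -> `|u s| <= g s) ->
  `|vintegral0 u t| <= integral0 g t.
Proof.
move=> /continuous3P[c1 c2 c3] cg ug; apply/norm3_le; split=> /=;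
  by apply: integral0_le => // s /ug/norm3_le[].
Qed.

Lemma vintegral0B (u v : R -> E) t : continuous u -> continuous v ->
  vintegral0 u t - vintegral0 v t = vintegral0 (fun s => u s - v s) t.
Proof.
move=> /continuous3P[c1 c2 c3] /continuous3P[d1 d2 d3].
rewrite [LHS]/(_ - _) /vintegral0/= -!integral0B//.
Qed.

Lemma continuous_vintegral0 (u : R -> E) : continuous u ->
  continuous (fun t : R => vintegral0 u (Num.max t 0)).
Proof.
by move=> /continuous3P[c1 c2 c3]; apply/continuous3P; split;
  exact: continuous_integral0.
Qed.

Lemma integral0_1 (t : R) : 0 <= t -> integral0 (fun=> 1) t = t.
Proof.
move=> t0; rewrite (@integral0_derive _ _ id _ (fun=> cvg_cst _) _ t0).
  by rewrite subr0.
Qed.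

End coordinates.

(** * The Picard operator *)

(** The integral equation [u t = x0 + int_0^t G (u s) ds + b t] in R^3. The
planar part of [G] is bounded by [1], the perturbation [b] has no planar part,
and for every [N] the map [G] is Lipschitz on the set of points whose planar
part is within distance [N] of that of [x0]. *)
Section picard.
Context {R : realType}.
Local Notation E := (R * R * R)%type.
Variables (G : E -> E) (x0 : E) (b : R -> E).

(** The Picard operator; the time is truncated at [0]. *)
Definition picard (u : R -> E) (t : R) : E :=
  x0 + vintegral0 (G \o u) (Num.max t 0) + b (Num.max t 0).

(** The Picard iterates started from the constant path [x0]. *)
Definition picard_iter n : R -> E := iter n picard (fun=> x0).

(** The coordinatewise pointwise limit of the Picard iterates. *)
Definition picard_lim (t : R) : E :=
  (limn (fun n => (picard_iter n t).1.1), limn (fun n => (picard_iter n t).1.2),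
   limn (fun n => (picard_iter n t).2)).

Hypothesis cG : continuous G.
Hypothesis cb : continuous b.
Hypothesis speed : forall x, `|(G x).1| <= 1.
Hypothesis b1 : forall t, (b t).1 = 0.
Hypothesis lipG : forall N : R, exists2 L, 0 < L & forall x y,
  `|x.1 - x0.1| <= N -> `|y.1 - x0.1| <= N -> `|G x - G y| <= L * `|x - y|.

Lemma continuous_Gcomp (u : R -> E) : continuous u -> continuous (G \o u).
Proof. by move=> cu s; apply: continuous_comp; [exact: cu|exact: cG]. Qed.

Lemma continuous_picard (u : R -> E) : continuous u -> continuous (picard u).
Proof.
move=> cu t; apply: cvgD.
  apply: cvgD; first exact: cvg_cst.
  exact: continuous_vintegral0 (continuous_Gcomp cu) t.
apply: (@continuous_comp _ _ _ (fun t : R => Num.max t 0) b).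
  exact: continuous_maxr0.
exact: cb.
Qed.

(** The unit speed bound: whatever the path [u], the planar part of [picard u]
moves by at most [t] up to time [t]. *)
Lemma picard_ball (u : R -> E) (N t : R) : continuous u -> 0 <= t <= N ->
  `|(picard u t).1 - x0.1| <= N.
Proof.
move=> /continuous_Gcomp/continuous3P[c1 c2 _] /andP[t0 tN].
have -> : (picard u t).1 - x0.1 = (vintegral0 (G \o u) t).1.
  rewrite /picard/= max_l// -[LHS]/(x0.1 + _ + (b t).1 - x0.1) b1.
  by rewrite addr0 addrAC subrr add0r.
apply: le_trans tN.
have unit_speed f : continuous f -> (forall s, `|f s| <= 1) ->
    `|integral0 f t| <= t.
  move=> cf f1; rewrite -[X in _ <= X](integral0_1 t0).
  by apply: integral0_le => //; exact: cst_continuous.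
rewrite prod_normE ge_max /=; apply/andP.
by split; apply: unit_speed => // s;
  have := speed (u s); rewrite prod_normE ge_max => /andP[].
Qed.

(** The contraction by [1/2] in the weighted norm [sup exp (- 2 L t) |u t|]
over [[0, N]], for paths that stay where [G] is [L]-Lipschitz. *)
Lemma picard_contract (N L C : R) (u v : R -> E) : 0 < L -> 0 <= C ->
  (forall x y, `|x.1 - x0.1| <= N -> `|y.1 - x0.1| <= N ->
    `|G x - G y| <= L * `|x - y|) ->
  continuous u -> continuous v ->
  (forall t, 0 <= t <= N -> `|(u t).1 - x0.1| <= N) ->
  (forall t, 0 <= t <= N -> `|(v t).1 - x0.1| <= N) ->
  (forall t, 0 <= t <= N -> `|u t - v t| <= C * expR (2 * L * t)) ->
  forall t, 0 <= t <= N ->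
    `|picard u t - picard v t| <= C / 2 * expR (2 * L * t).
Proof.
move=> L0 C0 lipN cu cv uN vN uv t /andP[t0 tN].
have -> : picard u t - picard v t =
    vintegral0 (fun s => G (u s) - G (v s)) t.
  rewrite /picard max_l// -vintegral0B; try exact: continuous_Gcomp.
  rewrite opprD opprD addrACA subrr addr0 addrACA subrr add0r //.
apply: le_trans (integral0_expR L0 t0 C0).
apply: vintegral0_le.
- by move=> s; apply: cvgB; exact: continuous_Gcomp.
- by move=> s; apply: cvgMr; exact: continuous_expRM.
move=> s /andP[s0 st].
have sN : 0 <= s <= N by rewrite s0 (le_trans st).
apply: (le_trans (lipN _ _ (uN s sN) (vN s sN))).
by rewrite ler_pM2l// uv.
Qed.

Lemma continuous_bounded_segment (u : R -> E) N : continuous u ->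
  exists2 C, 0 <= C & forall t, 0 <= t <= N -> `|u t| <= C.
Proof.
move=> cu.
have /compact_bounded : compact (u @` `[0, N]).
  apply: continuous_compact; first exact: continuous_subspaceT.
  exact: segment_compact.
move=> /pinfty_ex_gt0[C C0 HC]; exists C; first exact: ltW.
by move=> t tN; apply: HC; exists t => //=; rewrite in_itv.
Qed.

Lemma picard_fixed_unique (u v : R -> E) : continuous u -> continuous v ->
  (forall t, 0 <= t -> u t = picard u t) ->
  (forall t, 0 <= t -> v t = picard v t) ->
  forall t, 0 <= t -> u t = v t.
Proof.
move=> cu cv Hu Hv N N0.
have [L L0 lipN] := lipG N.
have cuv : continuous (fun t => u t - v t).
  by move=> s; apply: cvgB; [exact: cu|exact: cv].
have [C C0 uvC] := continuous_bounded_segment N cuv.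
have uN t : 0 <= t <= N -> `|(u t).1 - x0.1| <= N.
  by move=> /[dup] /andP[t0 _] tN; rewrite Hu//; exact: picard_ball.
have vN t : 0 <= t <= N -> `|(v t).1 - x0.1| <= N.
  by move=> /[dup] /andP[t0 _] tN; rewrite Hv//; exact: picard_ball.
have key n t : 0 <= t <= N -> `|u t - v t| <= C / 2 ^+ n * expR (2 * L * t).
  elim: n t => [|n IH] t tN.
    rewrite expr0 divr1 (le_trans (uvC _ tN))// ler_peMr//.
    rewrite -expR0 ler_expR; case/andP: tN => t0 _.
    by rewrite mulr_ge0// mulr_ge0// ltW.
  have t0 : 0 <= t by case/andP: tN.
  rewrite Hu// Hv//.
  have -> : C / 2 ^+ n.+1 = C / 2 ^+ n / 2.
    by rewrite exprSr invfM mulrA.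
  by apply: picard_contract tN => //; rewrite divr_ge0.
apply: (@eq_of_geometric_bound _ _ _ _ (C * expR (2 * L * N))) => n.
by rewrite mulrAC key// N0 lexx.
Qed.

Lemma picard_max0 (u : R -> E) t : picard u (Num.max t 0) = picard u t.
Proof. by rewrite /picard (@max_l _ _ (Num.max t 0))// maxr0_ge0. Qed.

Lemma picard_iter_max0 n t : picard_iter n (Num.max t 0) = picard_iter n t.
Proof. by case: n => //= n; exact: picard_max0. Qed.

Lemma picard_lim_max0 t : picard_lim (Num.max t 0) = picard_lim t.
Proof.
rewrite /picard_lim; congr (limn _, limn _, limn _);
  by apply/funext => n; rewrite picard_iter_max0.
Qed.

Lemma continuous_picard_iter n : continuous (picard_iter n).
Proof.
elim: n => [|n IH]; first exact: cst_continuous.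
exact: continuous_picard.
Qed.

Lemma picard_iter_ball n (N t : R) : 0 <= t <= N ->
  `|(picard_iter n t).1 - x0.1| <= N.
Proof.
case: n => [/andP[t0 tN]|n tN]; first by rewrite subrr normr0 (le_trans t0).
by apply: picard_ball => //; exact: continuous_picard_iter.
Qed.

Lemma picard_iter_step (N : R) : exists D, forall n t, 0 <= t <= N ->
  `|picard_iter n.+1 t - picard_iter n t| <= D / 2 ^+ n.
Proof.
have [L L0 lipN] := lipG N.
have [|C C0 HC] := @continuous_bounded_segment
    (fun t => picard_iter 1 t - picard_iter 0 t) N.
  by move=> s; apply: cvgB; exact: continuous_picard_iter.
have key n t : 0 <= t <= N ->
    `|picard_iter n.+1 t - picard_iter n t| <= C / 2 ^+ n * expR (2 * L * t).
  elim: n t => [|n IH] t tN.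
    rewrite expr0 divr1 (le_trans (HC _ tN))// ler_peMr//.
    rewrite -expR0 ler_expR; case/andP: tN => t0 _.
    by rewrite mulr_ge0// mulr_ge0// ltW.
  have -> : C / 2 ^+ n.+1 = C / 2 ^+ n / 2.
    by rewrite exprSr invfM mulrA.
  apply: (@picard_contract _ _ _ (picard_iter n.+1) (picard_iter n) L0 _ lipN)
    tN => //; try exact: continuous_picard_iter.
  - by rewrite divr_ge0.
  - by move=> s; exact: picard_iter_ball.
  - by move=> s; exact: picard_iter_ball.
exists (C * expR (2 * L * N)) => n t tN; apply: (le_trans (key n t tN)).
rewrite mulrAC ler_wpM2r// ?invr_ge0// ler_wpM2l// ler_expR.
by case/andP: tN => _ tN; rewrite ler_wpM2l// mulr_ge0// ltW.
Qed.

Lemma picard_iter_cvg t :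
  [/\ (picard_iter n t).1.1 @[n --> \oo] --> (picard_lim t).1.1,
      (picard_iter n t).1.2 @[n --> \oo] --> (picard_lim t).1.2 &
      (picard_iter n t).2 @[n --> \oo] --> (picard_lim t).2].
Proof.
have [D HD] := picard_iter_step (Num.max t 0).
have {}HD n : `|picard_iter n.+1 t - picard_iter n t| <= D / 2 ^+ n.
  by rewrite -!(picard_iter_max0 _ t) HD// maxr0_ge0 lexx.
by split; apply: (proj1 (@geometric_step_cvg _ _ D _)) => n;
  have /norm3_le[] := HD n.
Qed.

Lemma picard_lim_dist (N : R) : exists D, forall n t, 0 <= t <= N ->
  `|picard_lim t - picard_iter n t| <= D / 2 ^+ n.
Proof.
have [D HD] := picard_iter_step N.
exists (2 * D) => n t tN; apply/norm3_le; split;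
  by apply: (proj2 (@geometric_step_cvg _ _ D _)) => m;
  have /norm3_le[] := HD m t tN.
Qed.

Lemma picard_lim_ball (N t : R) : 0 <= t <= N ->
  `|(picard_lim t).1 - x0.1| <= N.
Proof.
move=> tN; apply/ler_addgt0Pr => e e0.
have [D HD] := picard_lim_dist N; have [n nD] := geometric_small D e0.
apply: (le_trans (ler_distD (picard_iter n t).1 _ _)).
rewrite addrC lerD//; first exact: picard_iter_ball.
rewrite (le_trans _ nD)// (le_trans _ (HD n t tN))//.
exact: (norm_fst_le (picard_lim t - picard_iter n t)).
Qed.

Lemma continuous_picard_lim : continuous picard_lim.
Proof.
move=> t; apply/cvgrPdist_le => e e0.
(* The bound [N] holds on a neighbourhood of [t], not only at [t]. *)
pose N := Num.max t 0 + 1.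
have [D HD] := picard_lim_dist N.
have e30 : 0 < e / 3 by rewrite divr_gt0.
have [n nD] := geometric_small D e30.
have dist s : Num.max s 0 <= N -> `|picard_lim s - picard_iter n s| <= e / 3.
  move=> sN; rewrite -picard_lim_max0 -picard_iter_max0.
  by rewrite (le_trans _ nD)// HD// maxr0_ge0.
have tN : Num.max t 0 <= N by rewrite /N lerDl.
have /cvgrPdist_le/(_ _ e30) cn := @continuous_picard_iter n t.
have ltN : Num.max t 0 < N by rewrite /N ltrDl.
near=> s.
have sN : Num.max s 0 <= N.
  near: s; apply: (cvgr_le (Num.max t 0)) => //.
  exact: continuous_maxr0.
have ts : `|picard_iter n t - picard_iter n s| <= e / 3 by near: s.
rewrite (le_trans (ler_distD (picard_iter n t) _ _))//.
have -> : e = e / 3 + (e / 3 + e / 3) by field.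
rewrite lerD ?dist// (le_trans (ler_distD (picard_iter n s) _ _))//.
by rewrite lerD ?ts// distrC dist.
Unshelve. all: by end_near. Qed.

Lemma picard_lim_fixed t : 0 <= t -> picard_lim t = picard picard_lim t.
Proof.
move=> t0; have [L L0 lipN] := lipG t; have [D HD] := picard_lim_dist t.
have D0 : 0 <= D.
  by have := HD 0 0; rewrite lexx t0 expr0 divr1 => /(_ isT); exact: le_trans.
have tt : 0 <= t <= t by rewrite t0 lexx.
apply: (@eq_of_geometric_bound _ _ _ _ (D + D * expR (2 * L * t))) => n.
rewrite (le_trans (ler_distD (picard_iter n.+1 t) _ _))//.
rewrite mulrDl lerD//.
  rewrite (le_trans (HD _ _ tt))// ler_wpM2l// lef_pV2 ?posrE ?exprn_gt0//.
  by rewrite ler_eXn2l// ltr1n.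
rewrite distrC.
have -> : D * expR (2 * L * t) / 2 ^+ n =
    2 * (D / 2 ^+ n / 2 * expR (2 * L * t)).
  by field; rewrite expf_neq0.
apply: (@le_trans _ _ (D / 2 ^+ n / 2 * expR (2 * L * t))); last first.
  by rewrite ler_peMl// ?ler1n// mulr_ge0 ?expR_ge0// !divr_ge0.
apply: (@picard_contract _ _ _ picard_lim (picard_iter n) L0 _ lipN) tt => //.
- by rewrite divr_ge0.
- exact: continuous_picard_lim.
- exact: continuous_picard_iter.
- by move=> s; exact: picard_lim_ball.
- by move=> s; exact: picard_iter_ball.
move=> s /[dup] /andP[s0 _] st.
rewrite (le_trans (HD _ _ st))// ler_peMr ?divr_ge0//.
by rewrite -expR0 ler_expR mulr_ge0// mulr_ge0// ltW.
Qed.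

End picard.

(** * The vector field of the equation *)

Section vector_field.
Context {R : realType}.
Local Notation E := (R * R * R)%type.
Variable Psi : R * R -> R * R.

(** The drift of the equation at the point [x = (xi, alpha)] of R^3. *)
Definition drift (x : E) : E :=
  (tau x.2, dot (Psi x.1) (tau_perp x.2)).

Lemma norm_sub_le_derive (f df : R -> R) :
  (forall x : R, is_derive x 1 f (df x)) -> (forall x, `|df x| <= 1) ->
  forall x y, `|f x - f y| <= `|x - y|.
Proof.
move=> fdf df1 x y; wlog xy : x y / y <= x.
  by move=> H; have [/H//|/ltW/H] := leP y x; rewrite distrC (distrC x).
have cf : {within `[y, x], continuous f}.
  by apply: derivable_within_continuous => s _; have [] := fdf s.
have [c _ ->] := MVT_segment xy (fun s _ => fdf s) cf.
by rewrite normrM ler_piMl.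
Qed.

Lemma cos_sub_le (x y : R) : `|cos x - cos y| <= `|x - y|.
Proof.
apply: (@norm_sub_le_derive _ (fun x => - sin x)) => s.
by rewrite normrN sin_max.
Qed.

Lemma sin_sub_le (x y : R) : `|sin x - sin y| <= `|x - y|.
Proof. by apply: (@norm_sub_le_derive _ cos) => s; exact: cos_max. Qed.

(** The bound on the planar part that rules out explosion. *)
Lemma drift_speed x : `|(drift x).1| <= 1.
Proof. by rewrite prod_normE ge_max /= cos_max sin_max. Qed.

Hypothesis lipPsi : [locally [lipschitz Psi x | x in setT]].

Lemma continuous_drift : continuous drift.
Proof.
have /continuous3P[c1 c2 c3] : continuous (@id E) by move=> x; exact: cvg_id.
have cP : continuous (fun x : E => Psi x.1).
  move=> x; apply: (@continuous_comp _ _ _ fst Psi); first exact: cvg_fst.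
  exact: locally_lipschitz_continuous.
have ccos : continuous (fun x : E => cos x.2).
  move=> x; apply: (@continuous_comp _ _ _ snd cos); first exact: c3.
  exact: continuous_cos.
have csin : continuous (fun x : E => sin x.2).
  move=> x; apply: (@continuous_comp _ _ _ snd sin); first exact: c3.
  exact: continuous_sin.
apply/continuous3P; split => //= x.
rewrite /dot/=; apply: cvgD; apply: cvgM.
- apply: (@continuous_comp _ _ _ (fun x : E => Psi x.1) fst); first exact: cP.
  exact: cvg_fst.
- by apply: cvgN; exact: csin.
- apply: (@continuous_comp _ _ _ (fun x : E => Psi x.1) snd); first exact: cP.
  exact: cvg_snd.
- exact: ccos.
Qed.

Lemma dot_tau_perp_le (u v : R * R) (a b : R) :
  `|dot u (tau_perp a) - dot v (tau_perp b)| <=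
    2 * `|u - v| + 2 * `|v| * `|a - b|.
Proof.
have -> : dot u (tau_perp a) - dot v (tau_perp b) =
    dot (u - v) (tau_perp a) +
    (v.1 * (sin b - sin a) + v.2 * (cos a - cos b)).
  by rewrite /dot/=; ring.
have [u1 u2] : `|u.1 - v.1| <= `|u - v| /\ `|u.2 - v.2| <= `|u - v|.
  by rewrite prod_normE !le_max !lexx orbT.
have [v1 v2] : `|v.1| <= `|v| /\ `|v.2| <= `|v|.
  by rewrite prod_normE !le_max !lexx orbT.
rewrite (le_trans (ler_normD _ _))// lerD//.
  rewrite /dot/= (le_trans (ler_normD _ _))// !normrM normrN.
  rewrite mulr2n mulrDl !mul1r.
  rewrite lerD// -[leRHS]mulr1 ler_pM ?sin_max ?cos_max//.
rewrite (le_trans (ler_normD _ _))// !normrM mulr2n !mulrDl !mul1r.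
by rewrite lerD// ler_pM// ?cos_sub_le// distrC sin_sub_le.
Qed.

(** No restriction on the angle is needed: [tau] and [tau_perp] are globally
Lipschitz and bounded. *)
Lemma drift_lipschitz (c : R * R) (N : R) :
  exists2 L, 0 < L & forall x y : E,
    `|x.1 - c| <= N -> `|y.1 - c| <= N ->
    `|drift x - drift y| <= L * `|x - y|.
Proof.
pose K : set (R * R) := `[c.1 - N, c.1 + N] `*` `[c.2 - N, c.2 + N].
have cK : compact K by apply: compact_setX; exact: segment_compact.
have KP (z : R * R) : `|z - c| <= N -> K z.
  rewrite prod_normE ge_max /= => /andP[].
  rewrite !ler_norml => /andP[? ?] /andP[? ?].
  by rewrite /K; split => /=; rewrite in_itv/=; apply/andP; split; lra.
have [L L0 LK] := locally_lipschitz_compact lipPsi cK.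
have /compact_bounded/pinfty_ex_gt0[M M0 MK] : compact (Psi @` K).
  apply: continuous_compact => //.
  by apply: continuous_subspaceT; exact: locally_lipschitz_continuous.
exists (1 + (2 * L + 2 * M)); first lra.
move=> x y /KP Kx /KP Ky.
have d1 : `|x.1 - y.1| <= `|x - y| := norm_fst_le (x - y).
have d2 : `|x.2 - y.2| <= `|x - y| := norm_snd_le (x - y).
have LM0 : 0 <= (2 * L + 2 * M) * `|x - y| by rewrite mulr_ge0//; lra.
rewrite mulrDl mul1r; apply/norm3_le; split => /=.
- by rewrite (le_trans (cos_sub_le _ _))// (le_trans d2)// lerDl.
- by rewrite (le_trans (sin_sub_le _ _))// (le_trans d2)// lerDl.
rewrite (le_trans (dot_tau_perp_le _ _ _ _))// ler_wpDl//.
rewrite [leRHS]mulrDl -!mulrA lerD//.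
  by rewrite ler_pM2l// (le_trans (LK _ _ Kx Ky))// ler_pM2l.
by rewrite ler_pM2l// ler_pM//; apply: MK => //; exists y.1.
Qed.

End vector_field.

(** * Measurability *)

Section measurability.
Context {R : realType}.
Local Notation E := (R * R * R)%type.

(** Open sets of the plane belong to the product sigma-algebra, since they are
countable unions of open squares with rational centre. *)
Lemma open_measurable_prod (A : set (R * R)) : open A -> measurable A.
Proof.
move=> oA.
(* The radius is an inverse integer, so the squares form a countable family. *)
pose B (q : rat * rat * nat) : set (R * R) :=
  ball (ratr q.1.1 : R) (q.2.+1%:R^-1) `*` ball (ratr q.1.2 : R) (q.2.+1%:R^-1).
have -> : A = \bigcup_(q in [set q | B q `<=` A]) B q.
  apply/seteqP; split => [[x y] Axy|z [q /= BA /BA//]].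
  have [e /= e0 eA] := (@nbhs_ballP _ _ _ _).1 (oA _ Axy).
  have [n ne] : exists n : nat, n.+1%:R^-1 < e / 2.
    have e20 : 0 < e / 2 by rewrite divr_gt0.
    near \oo => n; exists n; near: n.
    exact: (near_infty_natSinv_lt (PosNum e20)).
  have {}ne : n.+1%:R^-1 + n.+1%:R^-1 < e by rewrite [ltRHS]splitr ltrD.
  have nx (r : R) : exists q : rat, `|r - ratr q| < n.+1%:R^-1.
    have /rat_in_itvoo[q] : r < r + n.+1%:R^-1 by rewrite ltrDl invr_gt0.
    rewrite in_itv/= => /andP[rq qr]; exists q.
    by rewrite distrC ger0_norm ?subr_ge0 ?ltrBlDl// ltW.
  have [q1 Hq1] := nx x; have [q2 Hq2] := nx y.
  exists (q1, q2, n) => /=; last first.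
    by split; rewrite /ball/= distrC.
  move=> [u v] [/= Hu Hv]; apply: eA.
  split; move: Hu Hv; rewrite /ball/= => Hu Hv.
    rewrite (le_lt_trans (ler_distD (ratr q1) _ _))//.
    by rewrite (lt_trans (ltrD Hq1 Hu)).
  rewrite (le_lt_trans (ler_distD (ratr q2) _ _))//.
  by rewrite (lt_trans (ltrD Hq2 Hv)).
rewrite bigcup_mkcond; apply: countable_bigcupT_measurable => // q.
by case: ifP => // _; apply: measurableX; rewrite ball_itv;
  exact: measurable_itv.
Unshelve. all: by end_near. Qed.

Lemma continuous_measurable_prod (h : R * R -> R) :
  continuous h -> measurable_fun setT h.
Proof.
move=> /continuousP ch; apply: (measurability _ (RGenOpens.measurableE R)).
move=> _ [_ [a [b ->] <-]]; rewrite setTI; apply: open_measurable_prod.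
exact/ch/interval_open.
Qed.

End measurability.

Section adapted_iterates.
Context {R : realType} {d : measure_display} {S : measurableType d}.
Local Notation E := (R * R * R)%type.

Lemma measurable3P (f : S -> E) : measurable_fun setT f <->
  [/\ measurable_fun setT (fun w => (f w).1.1),
      measurable_fun setT (fun w => (f w).1.2) &
      measurable_fun setT (fun w => (f w).2)].
Proof.
split=> [/measurable_fun_pairP[/measurable_fun_pairP[m1 m2] m3]//|[m1 m2 m3]].
by apply/measurable_fun_pairP; split => //; apply/measurable_fun_pairP; split.
Qed.

Lemma measurable_drift (Psi : R * R -> R * R) (f : S -> E) : continuous Psi ->
  measurable_fun setT f -> measurable_fun setT (drift Psi \o f).
Proof.
move=> cPsi /[dup] /measurable_fun_pairP[m12 _] /measurable3P[m1 m2 m3].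
have mcos : measurable_fun setT (fun w => cos (f w).2).
  apply: (measurableT_comp (f := cos)) m3.
  by apply: continuous_measurable_fun; exact: continuous_cos.
have msin : measurable_fun setT (fun w => sin (f w).2).
  apply: (measurableT_comp (f := sin)) m3.
  by apply: continuous_measurable_fun; exact: continuous_sin.
apply/measurable3P; split => //=.
apply: measurable_funD; apply: measurable_funM => //.
- apply: (measurableT_comp (f := fun z => (Psi z).1)) m12.
  apply: continuous_measurable_prod => z.
  by apply: (@continuous_comp _ _ _ Psi fst); [exact: cPsi|exact: cvg_fst].
- exact: measurable_funN.
- apply: (measurableT_comp (f := fun z => (Psi z).2)) m12.
  apply: continuous_measurable_prod => z.
  by apply: (@continuous_comp _ _ _ Psi snd); [exact: cPsi|exact: cvg_snd].
Qed.

Lemma measurable_integral0 (u : R -> S -> R) (t : R) : 0 <= t ->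
  (forall w, continuous (u^~ w)) ->
  (forall s, 0 <= s <= t -> measurable_fun setT (u s)) ->
  measurable_fun setT (fun w => integral0 (u^~ w) t).
Proof.
move=> t0 cu mu.
apply: (@measurable_fun_cvg _ _ _ _ (fun n w => riemann_sum (u^~ w) t n));
  last first.
  by move=> w _; exact: riemann_sum_cvg.
move=> n; apply: measurable_sum => k; apply: measurable_funM => //.
apply: mu; rewrite mulr_ge0 ?divr_ge0//=.
rewrite mulrCA ler_piMr// ler_pdivrMr// mul1r ler_nat.
exact: ltnW.
Qed.

(** If [x0] and the perturbation at times in [[0, t]] are measurable, so are the
Picard iterates at times in [[0, t]]. *)
Lemma measurable_picard_iter (Psi : R * R -> R * R) (x0 : S -> E)
    (b : S -> R -> E) (t : R) :
  continuous Psi -> continuous (drift Psi) -> (forall w, continuous (b w)) ->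
  measurable_fun setT x0 ->
  (forall s, 0 <= s <= t -> measurable_fun setT (b^~ s)) ->
  forall n s, 0 <= s <= t ->
    measurable_fun setT (fun w => picard_iter (drift Psi) (x0 w) (b w) n s).
Proof.
move=> cPsi cG cb mx0 mb; elim=> [//|n IH] s /[dup] st /andP[s0 s_le_t].
have cu w : continuous (picard_iter (drift Psi) (x0 w) (b w) n).
  exact: continuous_picard_iter.
have cGu w := (continuous3P _).1 (continuous_Gcomp cG (cu w)).
have mGu r : 0 <= r <= s -> measurable_fun setT
    (fun w => drift Psi (picard_iter (drift Psi) (x0 w) (b w) n r)).
  move=> /andP[r0 rs]; apply: measurable_drift => //.
  by apply: IH; rewrite r0 (le_trans rs).
have /measurable3P[x1 x2 x3] := mx0.
have /measurable3P[b1 b2 b3] := mb s st.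
rewrite /= /picard max_l//.
by apply/measurable3P; split => /=;
  (apply: measurable_funD; [apply: measurable_funD => //|by []]);
  (apply: measurable_integral0 => // [w|r /mGu/measurable3P[]//]);
  have [] := cGu w.
Qed.

Lemma measurable_picard_lim (Psi : R * R -> R * R) (x0 : S -> E)
    (b : S -> R -> E) (t : R) :
  [locally [lipschitz Psi x | x in setT]] -> (forall w, continuous (b w)) ->
  (forall w s, (b w s).1 = 0) ->
  measurable_fun setT x0 ->
  (forall s, 0 <= s <= t -> measurable_fun setT (b^~ s)) -> 0 <= t ->
  measurable_fun setT (fun w => picard_lim (drift Psi) (x0 w) (b w) t).
Proof.
move=> lipPsi cb b0 mx0 mb t0.
have mV n : measurable_fun setT
    (fun w => picard_iter (drift Psi) (x0 w) (b w) n t).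
  apply: measurable_picard_iter mb _ _ _ => //.
  - exact: locally_lipschitz_continuous.
  - exact: continuous_drift.
  - by rewrite t0 lexx.
have cv w := picard_iter_cvg (continuous_drift lipPsi) (cb w)
  (drift_speed Psi) (b0 w) (drift_lipschitz lipPsi (x0 w).1) t.
apply/measurable3P; split.
- apply: measurable_fun_cvg (fun w _ => let: And3 h _ _ := cv w in h) => n.
  by have /measurable3P[] := mV n.
- apply: measurable_fun_cvg (fun w _ => let: And3 _ h _ := cv w in h) => n.
  by have /measurable3P[] := mV n.
- apply: measurable_fun_cvg (fun w _ => let: And3 _ _ h := cv w in h) => n.
  by have /measurable3P[] := mV n.
Qed.

End adapted_iterates.

(** Measurability with respect to a sigma-algebra [G] is measurability on the
measurable space that carries [G]. *)
Lemma measurable_wrtP (d' : measure_display) (T : pointedType)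
    (U : measurableType d') (G : set (set T)) (f : T -> U) :
  sigma_algebra setT G ->
  measurable_wrt G f <-> measurable_fun [set: g_sigma_algebraType G] f.
Proof.
move=> sG; rewrite /measurable_wrt -{1}(measurable_g_measurableTypeE sG).
split=> [mf _ B mB|mf B mB]; first by rewrite setTI; exact: mf.
by rewrite -[X in measurable X]setTI; exact: mf.
Qed.

Lemma continuous_within_max0 (R : realType) (U : topologicalType)
    (f : R -> U) : {within `[0, +oo[, continuous f} ->
  continuous (fun t : R => f (Num.max t 0)).
Proof.
move=> /subspace_continuousP cf t.
have t0 : `[0, +oo[%classic (Num.max t 0).
  by rewrite /= in_itv/= andbT maxr0_ge0.
apply: cvg_comp (cf _ t0) => V /= nV.
have nV' : \forall s \near t,
    `[0, +oo[%classic (Num.max s 0) -> V (Num.max s 0) :=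
  continuous_maxr0 nV.
apply: filterS nV' => s; apply.
by rewrite /= in_itv/= andbT maxr0_ge0.
Qed.

(** * The solution of the stochastic equation *)

Section pathwise_solution.
Context {R : realType} {d : measure_display} {T : measurableType d}.
Local Notation E := (R * R * R)%type.
Variables (P : probability T R) (F : R -> set (set T)) (W : R -> T -> R).
Variables (Psi : R * R -> R * R) (sigma : R) (x0 : T -> E).

(** The perturbation of the integral equation for the path [w]: [0] in the
plane, [sigma * (W t w - W 0 w)] in the angle. It vanishes on the negligible
event where the path of [W] is not continuous. *)
Definition noise (w : T) (t : R) : E :=
  (0, if `[< {within `[0, +oo[, continuous (fun t => W t w)} >]
      then sigma * increment W 0 (Num.max t 0) w else 0).

Lemma noise0 w : noise w 0 = 0.
Proof. by rewrite /noise maxxx /increment subrr mulr0; case: ifP. Qed.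

Lemma continuous_noise w : continuous (noise w).
Proof.
apply/continuous3P; split => /=; try by move=> t; exact: cvg_cst.
case: asboolP => [cW|_] t; last exact: cvg_cst.
apply: cvgMr; apply: cvgB; last exact: cvg_cst.
exact: (continuous_within_max0 cW).
Qed.

(** The solution process, as the limit of the Picard iterates of each path. *)
Definition sde_solution (t : R) (w : T) : E :=
  picard_lim (drift Psi) (x0 w) (noise w) t.

(** Along a continuous path of [W], the Picard operator is the right-hand side
of the integral form of the stochastic equation. *)
Lemma picardE w (u : R -> E) t : 0 <= t ->
  {within `[0, +oo[, continuous (fun t => W t w)} ->
  picard (drift Psi) (x0 w) (noise w) u t =
    ((x0 w).1 + plane_integral `[0, t] (fun s => tau (u s).2),
     (x0 w).2 + \int[@lebesgue_measure R]_(s in `[0, t])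
          dot (Psi (u s).1) (tau_perp (u s).2)
      + sigma * increment W 0 t w).
Proof.
move=> t0 cW; rewrite /picard max_l// /noise asboolT// max_l//.
rewrite /vintegral0 /drift /plane_integral /=.
by congr (_, _); rewrite addr0.
Qed.

Hypothesis lipPsi : [locally [lipschitz Psi x | x in setT]].

Let cD := continuous_drift lipPsi.
Let cN := continuous_noise.
Let sD : forall x, `|(drift Psi x).1| <= 1 := drift_speed Psi.
Let lD w := drift_lipschitz lipPsi (x0 w).1.

Lemma sde_solution_fixed w t : 0 <= t ->
  sde_solution t w = picard (drift Psi) (x0 w) (noise w) (sde_solution^~ w) t.
Proof. by move=> t0; apply: picard_lim_fixed (lD w) _ t0. Qed.

Lemma sde_solution0 w : sde_solution 0 w = x0 w.
Proof.
rewrite sde_solution_fixed// /picard maxxx noise0 addr0 /vintegral0.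
by rewrite !integral0_at0 -[RHS]addr0.
Qed.

Lemma continuous_sde_solution w : continuous (sde_solution^~ w).
Proof. by apply: continuous_picard_lim (lD w). Qed.

Hypothesis usualF : usual_filtration P F.
Hypothesis bmW : brownian_motion P F W.

Lemma measurable_noise (t s : R) : 0 <= s <= t ->
  measurable_fun [set: g_sigma_algebraType (F t)] (noise^~ s).
Proof.
move=> /andP[s0 st]; have t0 := le_trans s0 st.
have sF := filtration_sigma_algebra usualF t0.
have mW r : 0 <= r <= t ->
    measurable_fun [set: g_sigma_algebraType (F t)] (W r).
  move=> /andP[r0 rt]; apply/measurable_wrtP => // B mB.
  exact: (filtration_mono usualF r0 rt) _ (brownian_adapted bmW r0 mB).
apply/measurable3P; split => //=.
apply: measurable_fun_ifT => //.
- apply: (measurable_fun_bool false); rewrite setTI.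
  rewrite (measurable_g_measurableTypeE sF).
  (* The exceptional event is negligible, hence in [F 0] by completeness. *)
  apply: (filtration_mono usualF (lexx 0) t0); apply: (filtration_null usualF).
  apply: negligibleS (brownian_continuous bmW) => w /= /asboolPn.
  exact.
- apply: measurable_funM => //; apply: measurable_funB; apply: mW.
    by rewrite max_l// s0.
  by rewrite lexx.
Qed.

Lemma solution_sde_solution : measurable_wrt (F 0) x0 ->
  solution P F W Psi sigma x0 sde_solution.
Proof.
move=> mx0; split.
- move=> t t0; have sF := filtration_sigma_algebra usualF t0.
  apply/measurable_wrtP => //.
  apply: (@measurable_picard_lim _ _ (g_sigma_algebraType (F t)) Psi x0 noise t
    lipPsi continuous_noise) => //.
    by apply/measurable_wrtP => // B /mx0; exact: (filtration_mono usualF).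
  exact: measurable_noise.
- by move=> w; apply: continuous_subspaceT; exact: continuous_sde_solution.
- by apply: aeW => w; exact: sde_solution0.
- apply: filterS (brownian_continuous bmW) => w cW t t0.
  rewrite sde_solution0; split; rewrite {1}sde_solution_fixed// picardE//.
Qed.

Lemma sde_solution_unique (Y : R -> T -> E) :
  solution P F W Psi sigma x0 Y -> indistinguishable P sde_solution Y.
Proof.
move=> solY; rewrite /indistinguishable.
have := solution_equation solY; have := solution_start solY.
apply: filterS3 (brownian_continuous bmW) => w cW Y0 eqY t t0.
(* [Y] is only continuous on the half-line: extend its path to the real line. *)
pose Yw s := Y (Num.max s 0) w.
have YwE s : 0 <= s -> Yw s = Y s w by move=> s0; rewrite /Yw max_l.
rewrite -YwE//.
have cYw : continuous Yw.
  have cY : {within `[0, +oo[, continuous (fun t => Y t w)}.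
    exact: (solution_continuous solY).
  move=> s; apply: (continuous_within_max0 cY).
apply: (picard_fixed_unique cD sD _ (lD w)
  (u := sde_solution^~ w) (b := noise w)) => //.
- exact: continuous_sde_solution.
- by move=> s; exact: sde_solution_fixed.
move=> s s0; rewrite picardE// YwE//.
have [e1 e2] := eqY s s0.
rewrite [LHS](surjective_pairing (Y s w)) e1 e2 Y0.
have YwE' r : r \in `[0, s]%classic -> Yw r = Y r w.
  by rewrite inE/= in_itv/= => /andP[r0 _]; exact: YwE.
congr (_ + _, _ + _ + _).
  by congr (_, _); apply: eq_Rintegral => r /YwE' ->.
by apply: eq_Rintegral => r /YwE' ->.
Qed.

End pathwise_solution.

Unset Implicit Arguments.

Theorem proposition4p1 (R : realType) (Psi : R * R -> R * R) (sigma : R)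
    (d : measure_display) (T : measurableType d) (P : probability T R)
    (F : R -> set (set T)) (W : R -> T -> R) :
  [locally [lipschitz Psi x | x in setT]] ->
  0 <= sigma ->
  usual_filtration P F ->
  brownian_motion P F W ->
  forall x0 : T -> R * R * R, measurable_wrt (F 0) x0 ->
  exists X : R -> T -> R * R * R,
    solution P F W Psi sigma x0 X /\
    forall Y : R -> T -> R * R * R,
      solution P F W Psi sigma x0 Y -> indistinguishable P X Y.

Proof.
move=> lipPsi _ usualF bmW x0 mx0.
exists (sde_solution W Psi sigma x0); split.
  exact: solution_sde_solution.
by move=> Y; exact: sde_solution_unique.
Qed.
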